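(* Let $G\subset AM(\mathcal{A}^* )$ be a finite group containing an antimorphism and let $\mathbf{u}$ be an infinite word whose language is invariant under all elements of $G$. If there exists an integer $N$ such that every factor of $\mathbf{u}$ of length at least $N$ contains all letters of $\mathcal{A}$, then $$\Delta\mathcal{C}(n)+\#G\ \ge\ \sum_{\Theta\in G^{(2)}}\bigl(\mathcal{P}_\Theta(n)+\mathcal{P}_\Theta(n+1)\bigr)\quad\text{for all } n\ge N.$$
   Context: $AM(\mathcal{A}^* )$ is the monoid (under composition) of all morphisms ($\nu(vw)=\nu(v)\nu(w)$) and antimorphisms ($\nu(vw)=\nu(w)\nu(v)$) of $\mathcal{A}^*$, with unit the identity. $G^{(2)}=\{\Theta\in G \mid \Theta \text{ is an antimorphism and } \Theta^2=\mathrm{Id}\}$. The language $\mathcal{L}(\mathbf{u})$ (set of factors) is invariant under $\Theta$ if $\Theta(\mathcal{L}(\mathbf{u}))\subseteq\mathcal{L}(\mathbf{u})$. $\mathcal{C}(n)$ is the number of factors of length $n$, $\Delta\mathcal{C}(n)=\mathcal{C}(n+1)-\mathcal{C}(n)$, and $\mathcal{P}_\Theta(n)$ is the number of factors $w$ of length $n$ with $\Theta(w)=w$. The alphabet $\mathcal{A}$ consists exactly of the letters occurring in $\mathbf{u}$.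
   Formalization: The alphabet is assumed to have at least two letters: on a one-letter alphabet the identity is itself an involutive antimorphism, so G = {Id} and the claim would read 0 + 1 ≥ 2, which is false. *)

(* Defs.v *)
From mathcomp Require Import all_boot all_order all_algebra finmap.
From mathcomp Require Import mathcomp_extra boolp classical_sets functions.
From mathcomp Require Import cardinality fsbigop.

Set Implicit Arguments.
Unset Strict Implicit.
Unset Printing Implicit Defensive.

Import Order.TTheory GRing.Theory Num.Theory.

Local Open Scope classical_set_scope.
Local Open Scope ring_scope.

Section Words.
Variable A : finType.

(* Preservation of the empty word follows from the two identities below. *)
Definition word_morphism (f : seq A -> seq A) : Prop :=
  forall v w, f (v ++ w) = f v ++ f w.

Definition word_antimorphism (f : seq A -> seq A) : Prop :=
  forall v w, f (v ++ w) = f w ++ f v.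

Definition AM : set (seq A -> seq A) :=
  [set f | word_morphism f \/ word_antimorphism f].

Record AM_group (G : set (seq A -> seq A)) : Prop := {
  AM_group_sub : G `<=` AM;
  AM_group_id : G id;
  AM_group_comp : forall f g, G f -> G g -> G (f \o g);
  AM_group_inv : forall f, G f ->
    exists g, [/\ G g, f \o g = id & g \o f = id]
}.

Definition involutive_antimorphisms (G : set (seq A -> seq A)) :
    set (seq A -> seq A) :=
  [set Theta | [/\ G Theta, word_antimorphism Theta & Theta \o Theta = id]].

Definition language (u : nat -> A) : set (seq A) :=
  [set w | exists i n, w = [seq u k | k <- iota i n]].

Definition invariant_under (L : set (seq A)) (Theta : seq A -> seq A) : Prop :=
  Theta @` L `<=` L.

Definition complexity (u : nat -> A) (n : nat) : nat :=
  #|[pred w : n.-tuple A | tval w \in language u]|.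

Definition delta_complexity (u : nat -> A) (n : nat) : int :=
  (complexity u n.+1)%:Z - (complexity u n)%:Z.

Definition pal_complexity (u : nat -> A) (Theta : seq A -> seq A) (n : nat) :
    nat :=
  #|[pred w : n.-tuple A |
      (tval w \in language u) && (Theta (tval w) == tval w)]|.

End Words.

(* Main.v *)
Require Import Defs.
From mathcomp Require Import all_boot all_order all_algebra finmap.
From mathcomp Require Import mathcomp_extra boolp classical_sets functions.
From mathcomp Require Import cardinality fsbigop.
From mathcomp Require Import zify.

Set Implicit Arguments.
Unset Strict Implicit.
Unset Printing Implicit Defensive.

Import Order.TTheory GRing.Theory Num.Theory.

Local Open Scope classical_set_scope.
Local Open Scope ring_scope.

(** In the Rauzy graph with vertices [L_n] and edges [L_(n+1)], an element of [G]
    is determined by its kind and its value on a factor containing all letters,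
    so every stabilizer is trivial or generated by one involutive antimorphism.
    Let [r] be the number of [G]-orbits of vertices.  By Burnside,
    [C(n) + sum P(n) <= #G * r].  Ordering the orbits by their first occurrence
    in [u], each orbit except the first is entered through an edge coming from
    an earlier orbit.  These [r - 1] edges lie in distinct [G]-orbits and have
    trivial stabilizers, because an antimorphism fixing an edge exchanges its
    endpoints.  Hence [#G * (r - 1) <= C(n+1) - sum P(n+1)]. *)

Lemma card_set_pairs (I J : finType) (Q : I -> J -> bool) :
  #|[set p : I * J | Q p.1 p.2]%SET| = (\sum_i #|[pred j | Q i j]|)%N.
Proof.
under eq_bigr => i _ do rewrite -sum1_card.
rewrite pair_big_dep /= -sum1_card.
by apply: eq_bigl => -[i j]; rewrite inE.
Qed.

(** * Length preservation and rigidity of morphisms and antimorphisms *)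

Section WordMaps.
Variable A : finType.
Implicit Types (f g : seq A -> seq A) (v w : seq A).

Lemma AM_nil f : AM f -> f [::] = [::].
Proof.
by move=> [] /(_ [::] [::]) /= /(congr1 size); rewrite size_cat;
  case: (f [::]) => //= x s; lia.
Qed.

(** Since [f [::] = [::]], injectivity keeps every letter from being erased. *)
Lemma AM_size_ge f w : AM f -> injective f -> (size w <= size (f w))%N.
Proof.
move=> AMf injf; elim: w => [//|a w IHw].
have fa_gt0 : (0 < size (f [:: a]))%N.
  rewrite lt0n size_eq0; apply/eqP => fa0.
  by have := injf [:: a] [::]; rewrite (AM_nil AMf) fa0 => /(_ erefl).
by rewrite -cat1s; case: AMf => ->; rewrite !size_cat /=; lia.
Qed.

Lemma AM_group_cancel (G : set (seq A -> seq A)) f : AM_group G -> G f ->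
  exists g, [/\ G g, cancel g f & cancel f g].
Proof.
move=> GG /(AM_group_inv GG)[g [Gg fg gf]]; exists g; split=> // w.
  by rewrite -[f _]/((f \o g) w) fg.
by rewrite -[g _]/((g \o f) w) gf.
Qed.

Lemma AM_group_inj (G : set (seq A -> seq A)) f : AM_group G -> G f ->
  injective f.
Proof. by move=> GG /(AM_group_cancel GG)[g [_ _ /can_inj]]. Qed.

(** Neither [f] nor its inverse can shorten a word. *)
Lemma AM_group_size (G : set (seq A -> seq A)) f w : AM_group G -> G f ->
  size (f w) = size w.
Proof.
move=> GG Gf; have [g [Gg _ gf]] := AM_group_cancel GG Gf.
apply/eqP; rewrite eqn_leq; apply/andP; split.
  rewrite -{2}(gf w).
  exact: AM_size_ge (AM_group_sub GG Gg) (AM_group_inj GG Gg).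
exact: AM_size_ge (AM_group_sub GG Gf) (AM_group_inj GG Gf).
Qed.

(** Length preservation splits [f w = w] letter by letter, so [f] fixes each letter of [w], hence
    the whole alphabet. *)
Lemma word_morphism_fix_id f w : (forall v, size (f v) = size v) ->
  word_morphism f -> f w = w -> (forall a, a \in w) -> f = id.
Proof.
move=> szf morf fw allw.
have fixa : forall a, a \in w -> f [:: a] = [:: a].
  elim: w fw {allw} => [//|b w IHw] /eqP.
  rewrite -cat1s morf eqseq_cat ?szf // => /andP[/eqP fb /eqP fw] a.
  by rewrite inE => /orP[/eqP ->|/IHw ->].
apply/funext; elim => [|a v IHv] /=.
  by apply/eqP; rewrite -size_eq0 szf.
by rewrite -cat1s morf IHv fixa.
Qed.

(** Two distinct letters are essential: over a single letter, reversal is the identity. *)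
Lemma word_antimorphism_neq_id f : (1 < #|A|)%N -> word_antimorphism f ->
  f <> id.
Proof.
move=> /card_gt1P[a [b [_ _ ab]]] anti fid.
by have := anti [:: a] [:: b]; rewrite fid /= => -[/eqP]; rewrite (negPf ab).
Qed.

Lemma word_antimorphism_comp f g : word_antimorphism f ->
  word_antimorphism g -> word_morphism (f \o g).
Proof. by move=> af ag v w; rewrite /= ag af. Qed.

End WordMaps.

Section Factors.
Variables (A : finType) (u : nat -> A).

Definition factor_at (i n : nat) : seq A := [seq u k | k <- iota i n].

Lemma size_factor_at i n : size (factor_at i n) = n.
Proof. by rewrite size_map size_iota. Qed.

Lemma factor_at_language i n : language u (factor_at i n).
Proof. by exists i, n. Qed.

Lemma language_factor_at w : language u w ->
  exists i, w = factor_at i (size w).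
Proof. by move=> [i [n ->]]; exists i; rewrite size_map size_iota. Qed.

Lemma factor_atS i n : factor_at i n.+1 = [:: u i] ++ factor_at i.+1 n.
Proof. by []. Qed.

Lemma factor_atSr i n : factor_at i n.+1 = factor_at i n ++ [:: u (i + n)%N].
Proof. by rewrite /factor_at -addn1 iotaD map_cat. Qed.

End Factors.

(** * Orbits of factors, ordered by first occurrence *)

Section Bound.
Variables (A : finType) (u : nat -> A) (G : set (seq A -> seq A)).
Hypothesis (A_gt1 : (1 < #|A|)%N) (GG : AM_group G) (finG : finite_set G).
Hypothesis invG : forall f, G f -> invariant_under (language u) f.

Local Notation fac := (factor_at u).
Local Notation F := (fset_set G).

Let sizeG f w : G f -> size (f w) = size w.
Proof. exact: AM_group_size. Qed.

Let langG f w : G f -> language u w -> language u (f w).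
Proof. by move=> Gf Lw; apply: (invG Gf); exists w. Qed.

Let G_of (h : F) : G (val h).
Proof. by have := valP h; rewrite in_fset_set // inE. Qed.

Let of_G f : G f -> exists h : F, val h = f.
Proof.
move=> Gf; have fF : f \in F by rewrite in_fset_set // inE.
by exists [` fF]%fset.
Qed.

Definition in_orbit_at n (w : seq A) (i : nat) : Prop :=
  exists2 g, G g & g (fac i n) = w.

(** This [phi] orders the orbits. A word in the orbit of no factor of length [n] gets a junk value,
    harmless because the property is conditional. *)
Lemma first_index_exists n : exists phi : seq A -> nat, forall w i,
  in_orbit_at n w i -> in_orbit_at n w (phi w) /\ (phi w <= i)%N.
Proof.
have /boolp.choice[phi phiP] : forall w, exists m, forall i,
    in_orbit_at n w i -> in_orbit_at n w m /\ (m <= i)%N; last by exists phi.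
move=> w; have [[i wi]|nw] := pselect (exists i, in_orbit_at n w i); last first.
  by exists 0%N => i wi; case: nw; exists i.
have exw : exists i, `[< in_orbit_at n w i >] by exists i; apply/asboolP.
case: (ex_minnP exw) => m /asboolP wm minm; exists m => j wj; split=> //.
exact/minm/asboolP.
Qed.

Section FixedLength.
Variables (n : nat) (phi : seq A -> nat).
Hypothesis phiP : forall w i,
  in_orbit_at n w i -> in_orbit_at n w (phi w) /\ (phi w <= i)%N.

Let orbit_fac i : in_orbit_at n (fac i n) i.
Proof. by exists id => //; exact: AM_group_id. Qed.

Let phi_fac_le i : (phi (fac i n) <= i)%N.
Proof. exact: (phiP (orbit_fac i)).2. Qed.

Let phi_le f i : G f -> (phi (f (fac i n)) <= phi (fac i n))%N.
Proof.
move=> Gf; have [[g Gg gE] _] := phiP (orbit_fac i).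
apply: (phiP _).2; exists (f \o g); first exact: AM_group_comp.
by rewrite /= gE.
Qed.

Let phi_inv f i j : G f -> f (fac i n) = fac j n ->
  phi (fac i n) = phi (fac j n).
Proof.
move=> Gf fE; have [g [Gg _ gf]] := AM_group_cancel GG Gf.
have gE : g (fac j n) = fac i n by rewrite -fE gf.
by apply/eqP; rewrite eqn_leq -{1}gE -{3}fE !phi_le.
Qed.

Hypothesis full : forall w, language u w -> (n <= size w)%N ->
  forall a : A, a \in w.

(* The word [fac i n.+1] is the edge of the Rauzy graph through which the orbit
   of [fac i.+1 n] is first entered; such an edge determines the orbit and has
   trivial stabilizer. *)
Lemma entering_edge_rigid i j k : G k ->
  phi (fac i.+1 n) = i.+1 -> phi (fac j.+1 n) = j.+1 ->
  k (fac i n.+1) = fac j n.+1 -> k = id /\ i = j.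
Proof.
move=> Gk phii phij kE; case: (AM_group_sub GG Gk) => [mk|ak].
  (* A morphism keeps the direction of edges, so the two right endpoints share an orbit and hence a
     first index. *)
  have kiE : k (fac i.+1 n) = fac j.+1 n.
    move/eqP: kE; rewrite !factor_atS mk eqseq_cat ?(sizeG _ Gk) //.
    by move=> /andP[_ /eqP].
  have ij : i = j by have := phi_inv Gk kiE; rewrite phii phij => -[].
  split=> //; rewrite -ij in kE.
  apply: (word_morphism_fix_id _ mk kE) => [v|]; first exact: sizeG.
  by apply: full; [exact: factor_at_language|rewrite size_factor_at].
(* An antimorphism reverses the edge: the left endpoint at [i] has first index [j.+1], the one at
   [j] has [i.+1]. This forces both [j < i] and [i < j]. *)
have kE1 : k (fac i n) = fac j.+1 n.
  move/eqP: kE; rewrite (factor_atSr u i) (factor_atS u j) ak eqseq_cat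
    ?(sizeG _ Gk) //.
  by move=> /andP[_ /eqP].
have kE2 : k (fac i.+1 n) = fac j n.
  move/eqP: kE; rewrite (factor_atS u i) (factor_atSr u j) ak eqseq_cat.
    by move=> /andP[/eqP].
  by rewrite (sizeG _ Gk) !size_factor_at.
have := phi_inv Gk kE1; have := phi_inv Gk kE2; rewrite phii phij.
by have := phi_fac_le i; have := phi_fac_le j; lia.
Qed.

(** The default of [insubd] is never reached for [f] in [G], which preserves length. *)
Definition act m (f : seq A -> seq A) (w : m.-tuple A) : m.-tuple A :=
  insubd w (f w).

Let val_act m f (w : m.-tuple A) : G f -> tval (act f w) = f w.
Proof. by move=> Gf; rewrite /act val_insubd sizeG // size_tuple eqxx. Qed.

(** * Counting vertices and edges through orbit representatives *)

Definition factor_tuple i m : m.-tuple A := map_tuple u (iota_tuple m i).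

(** As [phi] is constant on orbits, each orbit of factors contributes exactly one element, the one
    read where the orbit first occurs. *)
Definition orbit_representatives : {set n.-tuple A} :=
  [set w : n.-tuple A |
    (tval w \in language u) && (tval w == fac (phi w) n)]%SET.

Local Notation R := orbit_representatives.

Lemma in_representatives w : w \in R -> tval w = fac (phi w) n.
Proof. by rewrite inE => /andP[_ /eqP]. Qed.

Lemma representative_exists (w : n.-tuple A) : language u w ->
  exists2 p : F * n.-tuple A, p.2 \in R & val p.1 p.2 = w.
Proof.
move=> Lw; have [i wE] := language_factor_at Lw; rewrite size_tuple in wE.
have [[g Gg gE] _] := phiP (orbit_fac i); rewrite -wE in gE.
have [h hE] := of_G Gg; exists (h, factor_tuple (phi w) n) => /=; last first.
  by rewrite hE.
rewrite inE mem_set; last exact: factor_at_language.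
rewrite /= -/(fac _ _).
suff -> : phi (fac (phi w) n) = phi w by [].
by rewrite [in RHS]wE; apply: (phi_inv Gg); rewrite gE.
Qed.

(** The needed half of Burnside, by an injection. Writing [w = g r] with [r] a representative, send
    a pair with [h w = w] to [(h \o g, r)]. The image gives back [w], as [h (g r) = w]; then [g] is
    known and can be cancelled to recover [h]. *)
Lemma sum_fixed_le_representatives :
  (\sum_(h : F) pal_complexity u (val h) n <= #|{: F}| * #|R|)%N.
Proof.
rewrite -card_set_pairs -cardsT -cardsX.
have /choice[rep repP] : forall w : n.-tuple A, exists p : F * n.-tuple A,
    language u w -> p.2 \in R /\ val p.1 p.2 = w.
  move=> w; have [/representative_exists[p ? ?]|nLw] := pselect (language u w).
    by exists p.
  have [h _] := of_G (AM_group_id GG); exists (h, w) => /nLw; exact.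
have /choice[mulG mulGP] : forall p : F * F, exists h : F,
    val h = val p.1 \o val p.2.
  by move=> [f g]; apply: of_G; apply: AM_group_comp.
pose theta (p : F * n.-tuple A) := (mulG (p.1, (rep p.2).1), (rep p.2).2).
rewrite -(card_in_imset (f := theta)).
  apply/subset_leq_card/fintype.subsetP => _ /imsetP[[h w] + ->].
  by rewrite inE finset.in_setX finset.in_setT => /andP[/set_mem/repP[]].
move=> [h w] [h' w']; rewrite !inE /=.
move=> /andP[/set_mem/repP[_ rw] /eqP hw].
move=> /andP[/set_mem/repP[_ rw'] /eqP hw'] [hE rE].
have fE := congr1 val hE; rewrite !mulGP /= in fE.
have wE : w = w'.
  apply/val_inj => /=; rewrite -hw -hw' -rw -rw' -rE.
  exact: (congr1 (fun f => f (tval (rep w).2)) fE).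
rewrite -wE in fE *; congr (_, _); apply/val_inj/funext => v.
have [g [_ fg _]] := AM_group_cancel GG (G_of (rep w).1).
by have := congr1 (@^~ (g v)) fE; rewrite /= fg.
Qed.

(** In the Burnside sum the identity term counts all factors; of the other terms only the involutive
    antimorphisms are kept. *)
Lemma complexity_add_pal_le :
  (complexity u n + \sum_(h : F | val h \in involutive_antimorphisms G)
     pal_complexity u (val h) n <= #|{: F}| * #|R|)%N.
Proof.
apply: leq_trans sum_fixed_le_representatives.
have [e eE] := of_G (AM_group_id GG).
rewrite [leqRHS](bigD1 e) //= leq_add //.
  rewrite eE; apply/subset_leq_card/fintype.subsetP => w.
  by rewrite !inE eqxx andbT => /mem_set.
rewrite [leqRHS](bigID (fun h : F => val h \in involutive_antimorphisms G)) /=.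
apply: leq_trans (leq_addr _ _); rewrite big_mkcond [leqRHS]big_mkcond /=.
apply: leq_sum => h _; case: ifPn => // hI; rewrite andbT.
suff -> : h != e by [].
apply/eqP => he; move: hI; rewrite he eE in_setE => -[_ aid _].
exact: (word_antimorphism_neq_id A_gt1 aid).
Qed.

(** The left side counts two disjoint families of edges: the translates of the entering edges and
    the edges fixed by an involutive antimorphism. *)
Lemma representatives_add_pal_le :
  (#|{: F}| * #|R|.-1 + \sum_(h : F | val h \in involutive_antimorphisms G)
     pal_complexity u (val h) n.+1 <= complexity u n.+1)%N.
Proof.
(* The orbit of the prefix [r0] has first index 0 and no entering edge. For other representatives
   [phi] is positive, so [.-1] below is a true predecessor. *)
pose r0 := factor_tuple 0 n.
pose X := finset.setX [set: F]%SET (R :\ r0)%SET.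
pose edge (p : F * n.-tuple A) := act (val p.1) (factor_tuple (phi p.2).-1 n.+1).
pose Q (h : F) (w : n.+1.-tuple A) := [&& val h \in involutive_antimorphisms G,
  tval w \in language u & val h w == w].
have edgeE p : tval (edge p) = val p.1 (fac (phi p.2).-1 n.+1).
  by rewrite val_act.
have phiR r : r \in (R :\ r0)%SET ->
    [/\ tval r = fac (phi r).-1.+1 n & phi (fac (phi r).-1.+1 n) = (phi r).-1.+1].
  rewrite 2!inE => /andP[rr0 rR]; have rE := in_representatives rR.
  have phi_gt0 : (0 < phi r)%N.
    rewrite lt0n; apply: contra rr0 => /eqP phi0; apply/eqP/val_inj.
    by rewrite /= [tval r in LHS]rE phi0.
  by rewrite prednK // -rE.
have edge_inj : {in X &, injective edge}.
  move=> [g r] [g' r'] /finset.setXP[_ /phiR[rE phir]] /finset.setXP[_ /phiR[rE' phir']] eE.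
  have [k [Gk g'k kg']] := AM_group_cancel GG (G_of g').
  have := congr1 val eE; rewrite /= !edgeE /= => /(congr1 k).
  rewrite kg' => kE.
  have Gkg : G (k \o val g) by apply: AM_group_comp.
  have [kgid ij] := entering_edge_rigid Gkg phir phir' kE.
  congr (_, _); apply/val_inj => /=; last by rewrite rE rE' ij.
  by apply/funext => v; rewrite -[LHS]g'k -[k _]/((k \o val g) v) kgid.
(* Two involutive antimorphisms fixing the same edge compose to a morphism fixing a word with all
   letters, that is, to the identity; being involutions, they coincide. *)
have Q_inj : {in [set p | Q p.1 p.2]%SET &, injective snd}.
  move=> [h w] [h' w']; rewrite !inE /= => /and3P[+ Lw /eqP hw].
  rewrite in_setE => -[Gh ah hh] /and3P[+ _ /eqP hw'].
  rewrite in_setE => -[Gh' ah' _] ww'; rewrite -ww' in hw' *; congr (_, _).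
  have hh' : val h \o val h' = id.
    apply: (@word_morphism_fix_id _ _ w) => /=.
    - by move=> v; rewrite !sizeG.
    - exact: word_antimorphism_comp.
    - by rewrite hw' hw.
    - by move: Lw; rewrite in_setE => /full; rewrite size_tuple; apply.
  apply/val_inj/funext => v; apply: (AM_group_inj GG Gh).
  by rewrite -[LHS]/((val h \o val h) v) hh -[RHS]/((val h \o val h') v) hh'.
have -> : (\sum_(h : F | val h \in involutive_antimorphisms G)
     pal_complexity u (val h) n.+1 = #|[set p | Q p.1 p.2]%SET|)%N.
  rewrite card_set_pairs big_mkcond /=; apply: eq_bigr => h _; rewrite /Q.
  case: ifPn => hI; first by apply: eq_card => w; rewrite !inE.
  by apply/esym/eq_card0 => w; rewrite !inE.
have -> : (#|{: F}| * #|R|.-1 = #|X|)%N.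
  rewrite cardsX cardsT (cardsD1 r0 R).
  suff -> : r0 \in R by [].
  rewrite inE mem_set; last exact: factor_at_language.
  have /eqP -> : phi r0 == 0%N by rewrite -leqn0 phi_fac_le.
  by rewrite eqxx.
rewrite -(card_in_imset edge_inj) -(card_in_imset Q_inj) -cardsUI.
(* If [h] fixes the translate by [g] of an entering edge, its conjugate by [g] fixes the entering
   edge itself. Rigidity makes the conjugate, hence [h], the identity, which is no antimorphism. *)
set I := (_ :&: _)%SET; have -> : I = finset.set0.
  apply/setP => w; rewrite !inE; apply/negP => /andP[/imsetP[[g r]]].
  move=> /finset.setXP[_ /phiR[_ phir]] -> /imsetP[[h w']]; rewrite inE /=.
  move=> /and3P[+ _ /eqP hw] wE; rewrite in_setE => -[Gh ah _].
  rewrite -wE edgeE /= in hw.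
  have [k [Gk gk kg]] := AM_group_cancel GG (G_of g).
  have Gc : G (k \o (val h \o val g)) by do ?apply: AM_group_comp.
  have := entering_edge_rigid Gc phir phir.
  rewrite /= hw kg => /(_ erefl)[cid _].
  apply: (word_antimorphism_neq_id A_gt1 ah); apply/funext => v.
  by have := congr1 (fun f => val g (f (k v))) cid; rewrite /= !gk.
rewrite cards0 addn0; apply/subset_leq_card/fintype.subsetP => w.
rewrite !inE => /orP[/imsetP[[g r] _ ->]|/imsetP[[h w'] + ->]].
  rewrite edgeE; apply: langG => //; exact: factor_at_language.
by rewrite inE => /and3P[_ /set_mem].
Qed.

Lemma representatives_gt0 : (0 < #|R|)%N.
Proof.
have [|[h r] rR _] := @representative_exists (factor_tuple 0 n).
  exact: factor_at_language.
by apply/card_gt0P; exists r.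
Qed.

End FixedLength.
End Bound.

Theorem theorem4 (A : finType) (u : nat -> A) (G : set (seq A -> seq A))
    (N : nat) :
  (1 < #|A|)%N ->
  range u = setT ->
  AM_group G ->
  finite_set G ->
  (exists2 Theta, G Theta & word_antimorphism Theta) ->
  (forall Theta, G Theta -> invariant_under (language u) Theta) ->
  (forall w, language u w -> (N <= size w)%N -> forall a : A, a \in w) ->
  forall n : nat, (N <= n)%N ->
    \sum_(Theta \in involutive_antimorphisms G)
      ((pal_complexity u Theta n)%:Z + (pal_complexity u Theta n.+1)%:Z)
    <= delta_complexity u n + (#|` fset_set G|)%:Z.
Proof.
move=> A_gt1 _ GG finG _ invG fullN n Nn.
have full w : language u w -> (n <= size w)%N -> forall a : A, a \in w.
  by move=> Lw nw; apply: fullN => //; exact: leq_trans nw.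
have [phi phiP] := first_index_exists u G n.
have -> : \sum_(Theta \in involutive_antimorphisms G)
      ((pal_complexity u Theta n)%:Z + (pal_complexity u Theta n.+1)%:Z) =
    (\sum_(h : fset_set G | val h \in involutive_antimorphisms G)
       pal_complexity u (val h) n +
     \sum_(h : fset_set G | val h \in involutive_antimorphisms G)
       pal_complexity u (val h) n.+1)%N%:Z.
  have /setIidr IE : involutive_antimorphisms G `<=` G by move=> f [].
  rewrite -[in LHS]IE fsbig_mkcondr fsbig_finite // big_seq_fsetE.
  rewrite -big_mkcond /=.
  by rewrite big_split PoszD !(big_morph Posz PoszD erefl).
have := complexity_add_pal_le A_gt1 GG finG phiP.
have := representatives_add_pal_le A_gt1 GG finG invG phiP full.
(* With [r] positive, the bounds with [#G * r] and [#G * r.-1] differ by exactly one [#G]. *)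
have := representatives_gt0 GG finG phiP.
rewrite /delta_complexity cardfE.
case: #|_| => // r _ /=; nia.
Qed.
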